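(* Let $n,m,r\in\mathbb Z_+$ with $n\ge mr$. Let $\left\{{n\atop m}\right\}_{\ge r}$ denote the number of partitions of $\{1,\dots,n\}$ into $m$ sets, each of size at least $r$. Then \[\frac{m^n}{m^{mr}}\ \le\ \left\{{n\atop m}\right\}_{\ge r}\ \le\ \frac{m^n}{m!}.\]
   Context: The numbers $\left\{{n\atop m}\right\}_{\ge r}$ are the $r$-associated Stirling numbers (of the second kind). *)

(* Defs.v *)
From mathcomp Require Import all_boot all_order all_algebra.

Set Implicit Arguments.
Unset Strict Implicit.
Unset Printing Implicit Defensive.

(* The r-associated Stirling number of the second kind; the ground set is
   'I_n = {0, ..., n-1}, and [partition] already excludes the empty block. *)
Definition assoc_stirling2 (n m r : nat) : nat :=
  #|[set P : {set {set 'I_n}} |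
      [&& partition P [set: 'I_n],
          #|P| == m
        & [forall B in P, r <= #|B|]]]|.

(* Main.v *)
Require Import Defs.
From mathcomp Require Import all_boot all_order all_fingroup all_algebra.

(** Partitions into [m] blocks are compared with maps into a set of [m] labels,
    a map being sent to the partition into its fibres.

    Upper bound: numbering the blocks of a partition in any of the [m`!]
    possible ways gives a map to [m] labels.  Both the partition (the fibres)
    and the numbering (no block is empty) can be read off that map, so
    [m`!] times the number of partitions is at most [m ^ n]; see
    [label_blocks_inj].

    Lower bound: reserve the first [m * r] points, cut into [m] consecutive
    runs of length [r], and let the [j]-th run start the block labelled [j].
    The other [n - m * r] points may then join these blocks arbitrarily.  Every
    block has at least [r] points, and since the blocks are told apart by the
    runs they contain, distinct choices give distinct partitions; see
    [extend_runs_fibers] and [extend_runs_inj].  This leaves [m ^ (n - m * r)]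
    partitions. *)

Set Implicit Arguments.
Unset Strict Implicit.
Unset Printing Implicit Defensive.

(** * Fibre partitions *)

Lemma eq_preim_partition (T : finType) (rT rT' : eqType)
    (f : T -> rT) (g : T -> rT') (D : {set T}) :
  (forall x y, (f x == f y) = (g x == g y)) ->
  preim_partition f D = preim_partition g D.
Proof.
move=> fg; rewrite /preim_partition /equivalence_partition.
by apply: eq_imset => x; apply/setP=> y; rewrite !inE fg.
Qed.

(** Two points are identified exactly when one lies in the block of the other,
    a condition on the partition alone. *)
Lemma preim_partition_eq (T : finType) (rT rT' : eqType)
    (f : T -> rT) (g : T -> rT') :
  preim_partition f [set: T] = preim_partition g [set: T] ->
  forall x y, (f x == f y) = (g x == g y).
Proof.
have sameE (sT : eqType) (h : T -> sT) x y :
    (y \in pblock (preim_partition h [set: T]) x) = (h x == h y).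
  by rewrite pblock_equivalence_partition ?inE //; split=> // /eqP->.
by move=> fg x y; rewrite -!sameE fg.
Qed.

Lemma preim_partitionT (T rT : finType) (f : T -> rT) :
  preim_partition f [set: T] = [set f @^-1: [set y] | y in f @: [set: T]].
Proof.
rewrite -imset_comp /preim_partition /equivalence_partition.
by apply: eq_imset => x; apply/setP=> y; rewrite !inE eq_sym.
Qed.

Lemma card_preim_partition_surj (T rT : finType) (f : T -> rT) :
  (forall y, exists x, f x = y) -> #|preim_partition f [set: T]| = #|rT|.
Proof.
move=> f_surj; have fT : f @: [set: T] = [set: rT].
  by apply/setP=> y; rewrite inE; have [x <-] := f_surj y; rewrite imset_f.
rewrite preim_partitionT fT card_imset ?cardsT // => y z /setP eq_yz.
have [x fx] := f_surj y.
by have := eq_yz x; rewrite !inE fx eqxx => /esym/eqP.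
Qed.

(** * Upper bound: labelling the blocks *)

(** Ranks in [enum P] fix a reference numbering of the blocks, and [s] runs over
    all the others; [inord] loses nothing when [P] has at most [m.+1] blocks. *)
Definition label_blocks (T : finType) (m : nat)
    (Ps : {set {set T}} * 'S_m.+1) : {ffun T -> 'I_m.+1} :=
  [ffun x => Ps.2 (inord (index (pblock Ps.1 x) (enum Ps.1)))].

Lemma label_blocks_eq (T : finType) (m : nat) (P : {set {set T}})
    (s : 'S_m.+1) x y :
  partition P [set: T] -> #|P| = m.+1 ->
  (label_blocks (P, s) x == label_blocks (P, s) y)
    = (pblock P x == pblock P y).
Proof.
move=> partP cardP; rewrite !ffunE (inj_eq perm_inj) /=.
have inP z : pblock P z \in enum P.
  by rewrite mem_enum pblock_mem // (cover_partition partP) inE.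
have lt_idx z : index (pblock P z) (enum P) < m.+1.
  by rewrite -cardP cardE index_mem.
by rewrite -val_eqE /= !inordK // (inj_in_eq (index_inj set0 (s := _))).
Qed.

(** The fibres of the labelling recover the partition; as every block has a
    point, the labels of the points then recover the permutation. *)
Lemma label_blocks_inj (T : finType) (m : nat) :
  {in [pred Ps : {set {set T}} * 'S_m.+1 |
         partition Ps.1 [set: T] && (#|Ps.1| == m.+1)] &,
   injective (@label_blocks T m)}.
Proof.
move=> [P s] [Q t] /andP[/= partP /eqP cardP] /andP[/= partQ /eqP cardQ] eq_lab.
have PQ : P = Q.
  rewrite -(preim_partition_pblock partP) -(preim_partition_pblock partQ).
  apply: eq_preim_partition => x y.
  by rewrite -(label_blocks_eq s) // -(label_blocks_eq t) // eq_lab.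
move: eq_lab; rewrite -PQ => eq_lab; congr pair; apply/permP=> j.
(* The block of rank [j] is nonempty, so the label [s j] is attained. *)
have lt_jP : j < size (enum P) by rewrite -cardE cardP.
pose B := nth set0 (enum P) j.
have PB : B \in P by rewrite -mem_enum mem_nth.
have [x Bx] : exists x, x \in B.
  exact/set0Pn/(partition_neq0 partP PB).
have blockx : pblock P x = B by apply: def_pblock Bx; case/and3P: partP.
move/ffunP/(_ x): eq_lab; rewrite !ffunE /= blockx.
by rewrite /B index_uniq ?enum_uniq // inord_val.
Qed.

Lemma assoc_stirling2_fact_le (n m r : nat) :
  0 < m -> assoc_stirling2 n m r * m`! <= m ^ n.
Proof.
case: m => // m _; rewrite /assoc_stirling2.
set X := [set P | _].
have -> : m.+1`! = #|[set: 'S_m.+1]| by rewrite cardsT card_Sn.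
have -> : m.+1 ^ n = #|{ffun 'I_n -> 'I_m.+1}|.
  by rewrite card_ffun !card_ord.
rewrite -cardsX -(card_in_imset (f := @label_blocks _ m)) ?max_card //.
move=> Ps Qt; rewrite !inE !andbT => /and3P[partP cP _] /and3P[partQ cQ _].
by apply: label_blocks_inj; apply/andP.
Qed.

(** * Lower bound: extending a fixed family of runs *)

Definition extend_runs (m r k : nat) (g : {ffun 'I_k -> 'I_m.+1})
    (i : 'I_(m.+1 * r + k)) : 'I_m.+1 :=
  match split i with inl a => inord (a %/ r) | inr b => g b end.

Lemma run_subproof (m r : nat) (j : 'I_m) (a : 'I_r) : j * r + a < m * r.
Proof.
apply: leq_trans (leq_mul (ltn_ord j) (leqnn r)).
by rewrite mulSn addnC ltn_add2r.
Qed.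

Definition run (m r k : nat) (j : 'I_m) (a : 'I_r) : 'I_(m * r + k) :=
  lshift k (Ordinal (run_subproof j a)).

Lemma run_inj (m r k : nat) (j : 'I_m) : injective (@run m r k j).
Proof. by move=> a b /(congr1 val)/= /addnI/val_inj. Qed.

Lemma extend_runs_run m r k (g : {ffun 'I_k -> 'I_m.+1}) j (a : 'I_r) :
  extend_runs g (run k j a) = j.
Proof.
rewrite /extend_runs (unsplitK (inl _)) /=.
have r_gt0 : 0 < r by apply: leq_ltn_trans (ltn_ord a).
by rewrite divnMDl // divn_small // addn0 inord_val.
Qed.

Lemma extend_runs_rshift m r k (g : {ffun 'I_k -> 'I_m.+1}) b :
  extend_runs (r := r) g (rshift _ b) = g b.
Proof. by rewrite /extend_runs (unsplitK (inr _)). Qed.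

(** The fibre of [j] contains the whole [j]-th run. *)
Lemma extend_runs_fibers m r k (g : {ffun 'I_k -> 'I_m.+1}) j :
  r <= #|extend_runs (r := r) g @^-1: [set j]|.
Proof.
rewrite -[leqLHS](card_ord r) -cardsT -(card_imset _ (@run_inj _ _ k j)).
apply/subset_leq_card/subsetP=> _ /imsetP[a _ ->].
by rewrite !inE extend_runs_run.
Qed.

(** The run [j] marks the block labelled [j], so the value of [g] at a point is
    the index of the run sharing the block of that point. *)
Lemma extend_runs_inj m r k : 0 < r ->
  injective (fun g : {ffun 'I_k -> 'I_m.+1} =>
    preim_partition (extend_runs (r := r) g) [set: _]).
Proof.
case: r => // r _ g h /preim_partition_eq eq_gh; apply/ffunP=> b.
have := eq_gh (rshift _ b) (run k (g b) ord0).
by rewrite !extend_runs_rshift !extend_runs_run eqxx => /esym/eqP.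
Qed.

Lemma expn_le_assoc_stirling2 (n m r : nat) :
  0 < m -> 0 < r -> m * r <= n ->
  m ^ (n - m * r) <= assoc_stirling2 n m r.
Proof.
case: m => // m _ r_gt0 le_mrn; move: (subnKC le_mrn).
move: (n - _) => k <-.
have -> : m.+1 ^ k = #|[set: {ffun 'I_k -> 'I_m.+1}]|.
  by rewrite cardsT card_ffun !card_ord.
rewrite -(card_imset _ (@extend_runs_inj m r k r_gt0)).
apply/subset_leq_card/subsetP=> _ /imsetP[g _ ->].
rewrite inE preim_partitionP card_preim_partition_surj ?card_ord ?eqxx /=.
  rewrite preim_partitionT; apply/forall_inP=> _ /imsetP[j _ ->].
  exact: extend_runs_fibers.
by move=> j; exists (run k j (Ordinal r_gt0)); rewrite extend_runs_run.
Qed.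

(** * The two bounds *)

Import Order.TTheory GRing.Theory Num.Theory.
Local Open Scope ring_scope.

Theorem lemma4p1 (n m r : nat)
    (hn : (0 < n)%N) (hm : (0 < m)%N) (hr : (0 < r)%N)
    (hnmr : (m * r <= n)%N) :
  (m%:R ^+ n / m%:R ^+ (m * r)%N <= (assoc_stirling2 n m r)%:R :> rat) /\
  ((assoc_stirling2 n m r)%:R <= m%:R ^+ n / (m`!)%:R :> rat).
Proof.
split.
  rewrite -expfB_cond ?pnatr_eq0 ?eqn0Ngt ?hm //.
  by rewrite -natrX ler_nat expn_le_assoc_stirling2.
rewrite ler_pdivlMr ?ltr0n ?fact_gt0 //.
by rewrite -natrX -natrM ler_nat assoc_stirling2_fact_le.
Qed.
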